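(* Let $A\in\mathbb{R}^{n\times n}$, $B\in\mathbb{R}^{n\times m}$, $D=\Gamma\Gamma^{\top}$ with $\Gamma\in\mathbb{R}^{n\times r}$, $Q\in\mathbb{S}^n$ with $Q\succeq0$, $R\in\mathbb{S}^m$ with $R\succ0$, $\varpi\ge0$, and $\Sigma_0,\Sigma_{\rm f}\in\mathbb{S}^n_{++}$ with $\Sigma_0\neq\Sigma_{\rm f}$; assume $(A,B)$ is controllable and that the asymptotic point convergence assumption (defined in the context) holds. Then an asymptotic Hamiltonian-zero exists (i.e. $\lim_{t_{\rm f}\to+\infty}\mathrm{H}_{t_{\rm f}}=0$) if and only if $\varpi=0$ and, furthermore, there exists $\Sigma_{\rm s}\succ0$ such that $A\Sigma_{\rm s}+\Sigma_{\rm s}A^{\top}+D=0$ and $\operatorname{tr}(Q\Sigma_{\rm s})=0$.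
   Context: $\mathbb{S}^n$ denotes the real symmetric $n\times n$ matrices and $\mathbb{S}^n_{++}$ the positive-definite ones. Fixed-final-time covariance steering problem: for fixed $t_{\rm f}\in(0,+\infty)$, minimize over gains $K$ (piecewise continuous on compact intervals, with values in $\mathbb{R}^{m\times n}$) the cost $\tfrac12\int_0^{t_{\rm f}}\left(\varpi+\operatorname{tr}(Q\Sigma(t))+\operatorname{tr}(K(t)^{\top}RK(t)\Sigma(t))\right)dt$ subject to $\dot\Sigma=(A+BK)\Sigma+\Sigma(A+BK)^{\top}+D$, $\Sigma(0)=\Sigma_0$, $\Sigma(t_{\rm f})=\Sigma_{\rm f}$. It is known that for every $t_{\rm f}>0$ the boundary value problem $$\dot\Pi=-Q-A^{\top}\Pi-\Pi A+\Pi BR^{-1}B^{\top}\Pi,$$ $$\dot\Sigma=(A-BR^{-1}B^{\top}\Pi)\Sigma+\Sigma(A-BR^{-1}B^{\top}\Pi)^{\top}+D,\quad \Sigma(0)=\Sigma_0,\ \Sigma(t_{\rm f})=\Sigma_{\rm f}$$ ($\Pi(0),\Pi(t_{\rm f})$ free) has a unique solution on $[0,t_{\rm f}]$, denoted $(\Sigma_{t_{\rm f}}(\cdot),\Pi_{t_{\rm f}}(\cdot))$, with values in $\mathbb{S}^n_{++}\times\mathbb{S}^n$; it is the optimal covariance/co-state pair, with optimal gain $K=-R^{-1}B^{\top}\Pi_{t_{\rm f}}$. Hamiltonian: $\mathrm{H}(\Sigma,\Pi)=\tfrac12\varpi+\operatorname{tr}(\tfrac12Q\Sigma+\Pi A\Sigma)-\operatorname{tr}(\tfrac12\Pi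 BR^{-1}B^{\top}\Pi\Sigma-\tfrac12\Pi D)$. $\mathrm{H}_{t_{\rm f}}:=\mathrm{H}(\Sigma_{t_{\rm f}}(t),\Pi_{t_{\rm f}}(t))$, which does not depend on $t\in[0,t_{\rm f}]$. The candidate final time $+\infty$ is called an asymptotic Hamiltonian-zero if $\lim_{t_{\rm f}\to+\infty}\mathrm{H}_{t_{\rm f}}=0$. Asymptotic point convergence assumption: the limiting trajectory $\Sigma_\star(t)=\lim_{t_{\rm f}\to+\infty}\Sigma_{t_{\rm f}}(t)$, $t\ge0$, of the family of optimal covariance trajectories exists (pointwise in $t$) and has a bounded positive-definite limit: $\lim_{t\to+\infty}\Sigma_\star(t)=\Sigma_\infty\succ0$. *)

(* Defs.v *)
From mathcomp Require Import all_boot all_order all_algebra.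
From mathcomp Require Import all_classical all_reals all_analysis.
Set Implicit Arguments.
Unset Strict Implicit.
Unset Printing Implicit Defensive.
Import Order.TTheory GRing.Theory Num.Theory.
Import numFieldNormedType.Exports.
Local Open Scope classical_set_scope.
Local Open Scope ring_scope.

Definition symmetric_mx (K : realType) (n : nat) (M : 'M[K]_n) : Prop :=
  M^T = M.

Definition psd_mx (K : realType) (n : nat) (M : 'M[K]_n) : Prop :=
  symmetric_mx M /\ forall v : 'cV[K]_n, 0 <= (v^T *m M *m v) 0 0.

Definition pd_mx (K : realType) (n : nat) (M : 'M[K]_n) : Prop :=
  symmetric_mx M /\ forall v : 'cV[K]_n, v != 0 -> 0 < (v^T *m M *m v) 0 0.

(* [is_solution tf x dx]: x is a classical solution of x'(t) = dx(t) on the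
   closed interval [0, tf]. When dx is continuous on [0, tf], as it is in all
   uses below, continuity up to the endpoints together with the equation in the
   interior amounts to the equation holding at 0 and tf with one-sided
   derivatives. Values of x outside [0, tf] are irrelevant. *)
Definition is_solution (K : realType) (p q : nat) (tf : K)
    (x dx : K -> 'M[K]_(p, q)) : Prop :=
  {within `[0, tf], continuous x} /\
  forall t : K, 0 < t < tf -> is_derive t 1 x (dx t).

(* Controllability in Kalman's sense: any state is steered to any other in
   finite time. Continuous inputs suffice, since the minimum-energy steering
   input of a linear time-invariant system is continuous. *)
Definition controllable (K : realType) (n m : nat)
    (A : 'M[K]_n) (B : 'M[K]_(n, m)) : Prop :=
  forall x0 x1 : 'cV[K]_n,
  exists (T : K) (u : K -> 'cV[K]_m) (x : K -> 'cV[K]_n),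
    [/\ 0 < T, {within `[0, T], continuous u},
        is_solution T x (fun t => A *m x t + B *m u t),
        x 0 = x0 & x T = x1].

(* [bvp_solution ... tf Sigma Pi]: (Sigma, Pi) solves on [0, tf] the coupled
   Riccati / Lyapunov boundary value problem of covariance steering, with
   values in S^n_++ x S^n. *)
Definition bvp_solution (K : realType) (n m : nat)
    (A : 'M[K]_n) (B : 'M[K]_(n, m)) (D Q : 'M[K]_n) (R : 'M[K]_m)
    (Sigma0 Sigmaf : 'M[K]_n) (tf : K) (Sigma Pi : K -> 'M[K]_n) : Prop :=
  let Acl t := A - B *m invmx R *m B^T *m Pi t in
  [/\ forall t : K, 0 <= t <= tf -> pd_mx (Sigma t) /\ symmetric_mx (Pi t),
      is_solution tf Pi (fun t =>
        - Q - A^T *m Pi t - Pi t *m A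
        + Pi t *m B *m invmx R *m B^T *m Pi t),
      is_solution tf Sigma (fun t =>
        Acl t *m Sigma t + Sigma t *m (Acl t)^T + D),
      Sigma 0 = Sigma0
    & Sigma tf = Sigmaf].

Definition hamiltonian (K : realType) (n m : nat)
    (A : 'M[K]_n) (B : 'M[K]_(n, m)) (D Q : 'M[K]_n) (R : 'M[K]_m)
    (varpi : K) (Sigma Pi : 'M[K]_n) : K :=
  2^-1 * varpi
  + \tr (2^-1 *: (Q *m Sigma) + Pi *m A *m Sigma)
  - \tr (2^-1 *: (Pi *m B *m invmx R *m B^T *m Pi *m Sigma)
         - 2^-1 *: (Pi *m D)).

(* Families indexed by the final time: [Sigma tf t], [Pi tf t]. The Hamiltonian
   is constant along a solution of the boundary value problem, so its value
   H_tf is taken at the initial time. *)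
Definition asymptotic_hamiltonian_zero (K : realType) (n m : nat)
    (A : 'M[K]_n) (B : 'M[K]_(n, m)) (D Q : 'M[K]_n) (R : 'M[K]_m)
    (varpi : K) (Sigma Pi : K -> K -> 'M[K]_n) : Prop :=
  hamiltonian A B D Q R varpi (Sigma tf 0) (Pi tf 0) @[tf --> +oo] --> (0 : K).

Definition asymptotic_point_convergence (K : realType) (n : nat)
    (Sigma : K -> K -> 'M[K]_n) : Prop :=
  exists (Sigma_star : K -> 'M[K]_n) (Sigma_infty : 'M[K]_n),
    [/\ forall t : K, 0 <= t -> Sigma tf t @[tf --> +oo] --> Sigma_star t,
        Sigma_star t @[t --> +oo] --> Sigma_infty
      & pd_mx Sigma_infty].

(* Main.v *)
(* Write S = B R^-1 B^T and let h(X, P) be twice the Hamiltonian at covariance X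
   and co-state P, up to the constant varpi. Completing the square along a
   trajectory steering v to 0 (resp. 0 to v) bounds v^T Pi_tf(t) v from above
   (resp. below) independently of tf, so controllability bounds Pi_tf uniformly
   away from both ends of [0, tf]. Hence Sigma_tf solves a linear equation with
   uniformly bounded coefficients there, and the pointwise convergence upgrades
   to uniform closeness of Sigma_tf to Sigma_oo on arbitrarily long windows.

   On such a window two identities control the conserved value h_tf. First, h is
   concave in P with gradient Sigma', so
     h(Sigma, Z) <= h_tf + tr((Z - Pi) Sigma'),
   and the mean value theorem for tr((Z - Pi)(Sigma - Sigma_oo)) makes the last
   term small at some time, whence liminf h_tf >= h(Sigma_oo, Z) for each
   symmetric Z. Second, h is affine in X with gradient - Pi', so
     h_tf = h(Y, Pi) - tr(Pi' (Sigma - Y)),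
   and the mean value theorem for tr(Pi (Sigma_oo - Y)) over a long window gives
   limsup h_tf <= sup_P h(Y, P) for each Y.

   If H_tf -> 0, the first bound with Z = d E, where E is the residual of the
   Lyapunov equation at Sigma_oo, and d -> 0 gives varpi = 0, tr(Q Sigma_oo) = 0
   and E = 0. Conversely the first bound with Z = 0 and the second with
   Y = Sigma_s squeeze H_tf to 0. *)
Require Import Defs.
From mathcomp Require Import all_boot all_order all_algebra.
From mathcomp Require Import all_classical all_reals all_analysis.
From mathcomp Require Import ring lra.
Import Order.TTheory GRing.Theory Num.Theory.
Import numFieldNormedType.Exports.
Set Implicit Arguments.
Unset Strict Implicit.
Unset Printing Implicit Defensive.
Local Open Scope classical_set_scope.
Local Open Scope ring_scope.

(** * Calculus of matrix-valued paths *)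

Section MatrixPaths.
Context {K : realType}.

Lemma mx_entry_le p q (M : 'M[K]_(p, q)) i j : `|M i j| <= `|M|.
Proof.
rewrite [leRHS]/Num.Def.normr/= mx_normrE.
exact: (le_bigmax _ (fun ij => `|M ij.1 ij.2|) (i, j)).
Qed.

Lemma mx_norm_le p q (M : 'M[K]_(p, q)) c :
  0 <= c -> (forall i j, `|M i j| <= c) -> `|M| <= c.
Proof.
move=> c0 Mc; rewrite [leLHS]/Num.Def.normr/= mx_normrE.
by rewrite (bigmax_le _ c0)//= => -[i j] _.
Qed.

(** The norm is the largest absolute entry, and an entry of the product is a sum of [q] terms; hence
    the factor [q%:R]. *)
Lemma mx_norm_mul p q r (M : 'M[K]_(p, q)) (N : 'M[K]_(q, r)) :
  `|M *m N| <= q%:R * `|M| * `|N|.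
Proof.
apply: mx_norm_le => [|i j]; first by rewrite !mulr_ge0.
rewrite mxE (le_trans (ler_norm_sum _ _ _))//.
rewrite (le_trans (ler_sum _ (G := fun=> `|M| * `|N|) _))//.
  by move=> k _; rewrite normrM ler_pM// mx_entry_le.
by rewrite sumr_const card_ord -mulrA mulr_natl.
Qed.

Lemma mx_norm_tr p q (M : 'M[K]_(p, q)) : `|M^T| <= `|M|.
Proof. by apply: mx_norm_le => // i j; rewrite mxE mx_entry_le. Qed.

Lemma mxtraceN p (M : 'M[K]_p) : \tr (- M) = - \tr M.
Proof. exact: raddfN. Qed.

Lemma mxtrace_norm p (M : 'M[K]_p) : `|\tr M| <= p%:R * `|M|.
Proof.
rewrite (le_trans (ler_norm_sum _ _ _))//.
rewrite (le_trans (ler_sum _ (G := fun=> `|M|) _))//.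
  by move=> k _; rewrite mx_entry_le.
by rewrite sumr_const card_ord mulr_natl.
Qed.

Lemma mxtrace_mul_norm p q (M : 'M[K]_(p, q)) (N : 'M[K]_(q, p)) :
  `|\tr (M *m N)| <= p%:R * q%:R * `|M| * `|N|.
Proof.
by rewrite (le_trans (mxtrace_norm _))// -!mulrA ler_wpM2l// mulrA mx_norm_mul.
Qed.

Lemma cvg_mxP {T : Type} (F : set_system T) {FF : Filter F} p q
    (x : T -> 'M[K]_(p, q)) (l : 'M[K]_(p, q)) :
  x @ F --> l <-> forall i j, (fun t => x t i j) @ F --> l i j.
Proof.
split=> [xl i j|xl].
  apply: (@continuous_cvg _ _ _ F FF x (fun M : 'M[K]_(p, q) => M i j)) => //.
  exact: coord_continuous.
apply/cvgrPdist_le => /= e e0; near=> t.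
apply: mx_norm_le; first exact: ltW.
move=> i j; rewrite !mxE.
have : forall ij : 'I_p * 'I_q, `|l ij.1 ij.2 - x t ij.1 ij.2| <= e.
  near: t; apply: filter_forall => ij.
  exact: ((cvgrPdist_le _ _).1 (xl ij.1 ij.2)).
by move/(_ (i, j)).
Unshelve. all: by end_near. Qed.

Lemma cvg_trmx {T : Type} (F : set_system T) {FF : Filter F} p q
    (x : T -> 'M[K]_(p, q)) (l : 'M[K]_(p, q)) :
  x @ F --> l -> (fun t => (x t)^T) @ F --> l^T.
Proof.
move=> /cvg_mxP xl; apply/cvg_mxP => i j; rewrite mxE.
by under eq_fun do rewrite mxE; exact: xl.
Qed.

Lemma cvg_mulmx {T : Type} (F : set_system T) {FF : Filter F} p q r
    (x : T -> 'M[K]_(p, q)) (y : T -> 'M[K]_(q, r))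
    (l : 'M[K]_(p, q)) (k : 'M[K]_(q, r)) :
  x @ F --> l -> y @ F --> k -> (fun t => x t *m y t) @ F --> l *m k.
Proof.
move=> /cvg_mxP xl /cvg_mxP yk; apply/cvg_mxP => i j; rewrite mxE.
under eq_fun do rewrite mxE.
apply: cvg_big => [|h _]; first exact: add_continuous.
exact: cvgM.
Qed.

Lemma cvg_mxtrace {T : Type} (F : set_system T) {FF : Filter F} p
    (x : T -> 'M[K]_p) (l : 'M[K]_p) :
  x @ F --> l -> (fun t => \tr (x t)) @ F --> \tr l.
Proof.
move=> /cvg_mxP xl.
by apply: cvg_big => [|h _]; [exact: add_continuous|exact: xl].
Qed.

Lemma is_derive_mxP p q (x : K -> 'M[K]_(p, q)) (t : K) (dx : 'M[K]_(p, q)) :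
  is_derive t 1 x dx <-> forall i j, is_derive t 1 (fun s => x s i j) (dx i j).
Proof.
split=> [[/derivable_mxP xt xdx] i j|xdx].
  split; first exact: xt.
  by rewrite -xdx derive_mx ?mxE//; exact/derivable_mxP.
have xt : derivable x t 1 by apply/derivable_mxP => i j; case: (xdx i j).
split=> //; rewrite derive_mx//; apply/matrixP => i j; rewrite mxE.
by case: (xdx i j).
Qed.

Lemma is_derive_sum_fun q (h : 'I_q -> K -> K) (t : K) (dh : 'I_q -> K) :
  (forall k, is_derive t 1 (h k) (dh k)) ->
  is_derive t 1 (fun s => \sum_k h k s) (\sum_k dh k).
Proof.
move=> hdh; rewrite (_ : (fun s => _) = \sum_k h k); first exact: is_derive_sum.
by apply/funext => s; rewrite fct_sumE.
Qed.

(** Extends [is_solution] to an arbitrary interval: [is_solution tf] is convertible to the case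
    [a = 0], [b = tf]. *)
Definition C1_path p q (a b : K) (x dx : K -> 'M[K]_(p, q)) : Prop :=
  {within `[a, b], continuous x} /\
  forall t : K, a < t < b -> is_derive t 1 x (dx t).

Lemma C1_path_sub p q (a b a' b' : K) (x dx : K -> 'M[K]_(p, q)) :
  a <= a' -> b' <= b -> C1_path a b x dx -> C1_path a' b' x dx.
Proof.
move=> aa' b'b [xc xd]; split=> [|t /andP[a't tb']]; last first.
  by apply: xd; rewrite (le_lt_trans aa')// (lt_le_trans tb').
apply: continuous_subspaceW xc => t /=; rewrite !in_itv/= => /andP[a't tb'].
by rewrite (le_trans aa')// (le_trans tb').
Qed.

Lemma C1_path_inside p q (a b : K) (x dx : K -> 'M[K]_(p, q)) :
  (forall t : K, a <= t <= b -> is_derive t 1 x (dx t)) -> C1_path a b x dx.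
Proof.
move=> xd; split=> [|t /andP[/ltW ? /ltW ?]]; last by apply: xd; apply/andP.
apply: derivable_within_continuous => t; rewrite in_itv/= => /xd.
by case.
Qed.

Lemma C1_path_cst p q (a b : K) (M : 'M[K]_(p, q)) :
  C1_path a b (fun=> M) (fun=> 0).
Proof.
split=> [|t _]; first by apply: continuous_subspaceT => t; exact: cvg_cst.
exact: is_derive_cst.
Qed.

Lemma C1_pathD p q a b (x dx y dy : K -> 'M[K]_(p, q)) :
  C1_path a b x dx -> C1_path a b y dy ->
  C1_path a b (fun t => x t + y t) (fun t => dx t + dy t).
Proof.
move=> [xc xd] [yc yd]; split=> [t|t tab]; first exact: cvgD (xc t) (yc t).
exact: (is_deriveD (xd t tab) (yd t tab)).
Qed.

Lemma C1_pathN p q (a b : K) (x dx : K -> 'M[K]_(p, q)) :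
  C1_path a b x dx -> C1_path a b (fun t => - x t) (fun t => - dx t).
Proof.
move=> [xc xd]; split=> [t|t tab]; first exact: cvgN (xc t).
exact: (is_deriveN (xd t tab)).
Qed.

Lemma C1_pathB p q a b (x dx y dy : K -> 'M[K]_(p, q)) :
  C1_path a b x dx -> C1_path a b y dy ->
  C1_path a b (fun t => x t - y t) (fun t => dx t - dy t).
Proof. by move=> xC yC; apply: C1_pathD => //; exact: C1_pathN. Qed.

Lemma C1_path_tr p q (a b : K) (x dx : K -> 'M[K]_(p, q)) :
  C1_path a b x dx -> C1_path a b (fun t => (x t)^T) (fun t => (dx t)^T).
Proof.
move=> [xc xd]; split=> [t|t tab].
  exact: cvg_trmx (xc t).
apply/is_derive_mxP => i j; under eq_fun do rewrite mxE; rewrite mxE.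
exact: ((is_derive_mxP _ _ _).1 (xd t tab)).
Qed.

Lemma C1_pathM p q r (a b : K)
    (x dx : K -> 'M[K]_(p, q)) (y dy : K -> 'M[K]_(q, r)) :
  C1_path a b x dx -> C1_path a b y dy ->
  C1_path a b (fun t => x t *m y t) (fun t => dx t *m y t + x t *m dy t).
Proof.
move=> [xc xd] [yc yd]; split=> [t|t tab].
  exact: cvg_mulmx (xc t) (yc t).
apply/is_derive_mxP => i j; under eq_fun do rewrite mxE.
rewrite !mxE -big_split/=.
apply: is_derive_sum_fun => k.
apply: is_derive_eq.
  apply: (is_deriveM ((is_derive_mxP _ _ _).1 (xd t tab) i k)).
  exact: ((is_derive_mxP _ _ _).1 (yd t tab) k j).
by rewrite /GRing.scale/=; ring.
Qed.

(** The mean value theorem needs a scalar function; the trace provides one. *)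
Lemma C1_path_MVT p (a b : K) (x dx : K -> 'M[K]_p) :
  a < b -> C1_path a b x dx ->
  exists2 c, a < c < b & \tr (x b) - \tr (x a) = \tr (dx c) * (b - a).
Proof.
move=> ab [xc xd].
have [||c] := @MVT K (fun t => \tr (x t)) (fun t => \tr (dx t)) a b ab.
- move=> t; rewrite in_itv/= => tab; rewrite /mxtrace.
  apply: is_derive_sum_fun => k.
  exact: ((is_derive_mxP _ _ _).1 (xd t tab)).
- by move=> t; exact: cvg_mxtrace (xc t).
by rewrite in_itv/=; exists c.
Qed.

Lemma is_derive_shifted p q (x : K -> 'M[K]_(p, q)) (t0 t : K) dx :
  is_derive (t0 + t) 1 x dx -> is_derive t 1 (fun s => x (t0 + s)) dx.
Proof.
move=> [xd xE].
have E : (fun h : K => h^-1 *: (((fun s => x (t0 + s)) \o shift t) (h *: (1 : K))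
            - x (t0 + t)))
       = (fun h : K => h^-1 *: ((x \o shift (t0 + t)) (h *: (1 : K)) - x (t0 + t))).
  by apply/funext => h /=; rewrite addrCA.
by split; [rewrite /derivable E|rewrite /derive E].
Qed.

Lemma C1_path_entry_MVT p q (a b : K) (x dx : K -> 'M[K]_(p, q)) i j :
  a < b -> C1_path a b x dx ->
  exists2 c, a < c < b & x b i j - x a i j = dx c i j * (b - a).
Proof.
move=> ab xC.
(* Tracing against an elementary matrix extracts a single entry. *)
have E (M : 'M[K]_(p, q)) : \tr ((delta_mx j i : 'M[K]_(q, p)) *m M) = M i j.
  rewrite mxtrace_mulC /mxtrace (bigD1 i)//= big1 ?addr0.
    rewrite mxE (bigD1 j)//= big1 ?addr0 ?mxE ?eqxx ?mulr1// => k kj.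
    by rewrite mxE (negPf kj) mulr0.
  by move=> k ki; rewrite mxE big1// => l _; rewrite mxE (negPf ki) andbF mulr0.
have [c cab] := C1_path_MVT ab (C1_pathM (C1_path_cst a b (delta_mx j i)) xC).
by rewrite mul0mx add0r !E; exists c.
Qed.

(* A Gronwall estimate on a short interval: at the point where the increment is
   largest, half of that increment is absorbed by the left-hand side. *)
Lemma C1_path_increment p q (a b h M al de : K) (x dx : K -> 'M[K]_(p, q)) :
  0 <= al -> 0 <= de -> a <= b -> b - a <= h -> h * al <= 2^-1 ->
  C1_path a b x dx -> `|x a| <= M ->
  (forall t, a < t < b -> `|dx t| <= al * `|x t| + de) ->
  forall s, a <= s <= b -> `|x s - x a| <= 2 * h * (al * M + de).
Proof.
move=> al0 de0 ab bah hal xC xaM dxb.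
have h0 : 0 <= h by apply: le_trans bah; rewrite subr_ge0.
have [|c] := @EVT_max K (fun t => `|x t - x a|) a b ab.
  by move=> t; apply: cvg_norm; apply: cvgB (xC.1 t) (cvg_cst _).
rewrite in_itv/= => /andP[ac cb] cmax s sab.
set mu := `|x c - x a| in cmax.
have mu_le : mu <= h * (al * (M + mu) + de).
  have M0 : 0 <= M by apply: le_trans xaM; exact: normr_ge0.
  have mu0 : 0 <= mu by exact: normr_ge0.
  have B0 : 0 <= al * (M + mu) + de by rewrite addr_ge0// mulr_ge0// addr_ge0.
  apply: mx_norm_le => [|i j]; first exact: mulr_ge0.
  rewrite !mxE; move: ac; rewrite le_eqVlt => /predU1P[<-|ac].
    by rewrite subrr normr0 mulr_ge0.
  have [d /andP[ad dc] ->] := C1_path_entry_MVT i j ac (C1_path_sub (lexx a) cb xC).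
  rewrite normrM mulrC ler_pM//.
    by rewrite ger0_norm ?subr_ge0 ?(ltW ac)//; apply: le_trans bah; rewrite lerB.
  apply: (le_trans (mx_entry_le _ _ _)).
  have db : d < b by exact: lt_le_trans cb.
  apply: (le_trans (dxb d _)); first by rewrite ad db.
  rewrite lerD2r ler_wpM2l//.
  have -> : x d = x a + (x d - x a) by rewrite addrC subrK.
  apply: (le_trans (ler_normD _ _)); rewrite lerD//.
  by apply: cmax; rewrite in_itv/= !ltW.
have mu0 : 0 <= mu by exact: normr_ge0.
apply: le_trans (cmax s _) _; first by rewrite in_itv.
nra.
Qed.

End MatrixPaths.

(** * Positive semidefinite matrices and their traces *)

Section PsdMatrices.
Context {K : realType}.

Lemma pd_mx_psd n (M : 'M[K]_n) : pd_mx M -> psd_mx M.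
Proof.
move=> [Ms Mp]; split=> // v.
have [->|/Mp/ltW//] := eqVneq v 0.
by rewrite mulmx0 mxE.
Qed.

Lemma psd_mx_congr n p (M : 'M[K]_n) (N : 'M[K]_(n, p)) :
  psd_mx M -> psd_mx (N^T *m M *m N).
Proof.
move=> [Ms Mp]; split; first by rewrite /symmetric_mx !trmx_mul trmxK Ms mulmxA.
by move=> v; rewrite !mulmxA -trmx_mul -(mulmxA _ N v) Mp.
Qed.

Lemma trmx_scalar11 (M : 'M[K]_1) : M^T = M.
Proof. by apply/matrixP => i j; rewrite mxE !ord1. Qed.

Lemma bilinear_symC n (M : 'M[K]_n) (u v : 'cV[K]_n) :
  symmetric_mx M -> (u^T *m M *m v) 0 0 = (v^T *m M *m u) 0 0.
Proof.
by move=> Ms; rewrite -[u^T *m M *m v]trmx_scalar11 !trmx_mul trmxK Ms mulmxA.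
Qed.

Lemma quadratic_formD n (M : 'M[K]_n) (u v : 'cV[K]_n) (c : K) :
  symmetric_mx M ->
  ((u + c *: v)^T *m M *m (u + c *: v)) 0 0 =
  (u^T *m M *m u) 0 0 + c * 2 * (u^T *m M *m v) 0 0
  + c ^+ 2 * (v^T *m M *m v) 0 0.
Proof.
move=> Ms; have -> : (u + c *: v)^T = u^T + c *: v^T.
  by apply/matrixP => i j; rewrite !mxE.
rewrite !mulmxDl !mulmxDr -!scalemxAl -!scalemxAr.
have := bilinear_symC v u Ms.
move: (u^T *m M *m u) (u^T *m M *m v) (v^T *m M *m u) (v^T *m M *m v).
by move=> a b d e; rewrite !mxE => ->; ring.
Qed.

Lemma delta_quadratic_form n (M : 'M[K]_n) i j :
  ((delta_mx i 0 : 'cV[K]_n)^T *m M *m (delta_mx j 0 : 'cV[K]_n)) 0 0 = M i j.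
Proof. by rewrite trmx_delta -rowE -colE !mxE. Qed.

Lemma psd_mx_diag_ge0 n (M : 'M[K]_n) i : psd_mx M -> 0 <= M i i.
Proof. by move=> [_ /(_ (delta_mx i 0))]; rewrite delta_quadratic_form. Qed.

Lemma mxtrace_psd n (M : 'M[K]_n) : psd_mx M -> 0 <= \tr M.
Proof. by move=> Mp; apply: sumr_ge0 => i _; exact: psd_mx_diag_ge0. Qed.

(** With a zero diagonal, the form at [e_i + c e_j] equals [2 c M i j]; taking [c = 1] and [c = -1]
    forces the entry to vanish. *)
Lemma psd_mx_diag_eq0 n (M : 'M[K]_n) :
  psd_mx M -> (forall i, M i i = 0) -> M = 0.
Proof.
move=> [Ms Mp] M0; apply/matrixP => i j; rewrite mxE.
have H c : 0 <= c * 2 * M i j.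
  have := Mp (delta_mx i 0 + c *: delta_mx j 0).
  by rewrite quadratic_formD// !delta_quadratic_form !M0 mulr0 addr0 add0r.
by have := H 1; have := H (-1); lra.
Qed.

(* Subtracting the rank-one matrix built from a column with positive diagonal
   entry is one step of Cholesky elimination. *)
Lemma psd_mx_pivot n (M : 'M[K]_n) i :
  psd_mx M -> 0 < M i i ->
  psd_mx (M - (M i i)^-1 *: (col i M *m (col i M)^T)).
Proof.
move=> [Ms Mp] Mi; split.
  by rewrite /symmetric_mx linearB/= linearZ/= trmx_mul trmxK Ms.
move=> v; set b := (v^T *m M *m (delta_mx i 0 : 'cV[K]_n)) 0 0.
(* This multiple of [e_i] minimises the form along the line through [v]; the minimum is
   [v^T M v - b^2 / M i i]. *)
have := Mp (v + (- (b / M i i)) *: delta_mx i 0).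
rewrite quadratic_formD// delta_quadratic_form -/b.
rewrite mulmxBr mulmxBl -scalemxAr -scalemxAl.
have : (v^T *m (col i M *m (col i M)^T) *m v) 0 0 = b * b.
  rewrite colE !mulmxA -(mulmxA (v^T *m M *m _)) mxE big_ord1 -/b.
  by rewrite trmx_mul Ms bilinear_symC.
move: (v^T *m (_ *m _) *m v) (v^T *m M *m v) => p q pE H; rewrite !mxE pE.
apply: (le_trans H); rewrite le_eqVlt; apply/orP; left; apply/eqP.
by field; rewrite gt_eqF.
Qed.

(** Induction on the number of nonzero diagonal entries: a pivot at [i] clears entry [i], and zero
    entries stay zero because pivoting only lowers the diagonal and keeps it nonnegative. *)
Lemma psd_mx_sum_rank1 n (M : 'M[K]_n) : psd_mx M ->
  exists s : seq 'cV[K]_n, M = \sum_(w <- s) w *m w^T.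
Proof.
have [k] := ubnP #|[pred i | M i i != 0]|; elim: k M => // k IH M kM Mp.
have [/existsP[i Mi]|] := boolP [exists i, M i i != 0]; last first.
  rewrite negb_exists => /forallP M0; exists [::]; rewrite big_nil.
  by apply: psd_mx_diag_eq0 => // i; apply/eqP; move: (M0 i); rewrite negbK.
have Mi0 : 0 < M i i by rewrite lt0r Mi psd_mx_diag_ge0.
have Np := psd_mx_pivot Mp Mi0; set N := (X in psd_mx X) in Np.
have NE j : N j j = M j j - (M i i)^-1 * M j i ^+ 2.
  by rewrite !mxE big_ord1 !mxE expr2.
have [|s Ns] := IH N _ Np.
  rewrite -ltnS (leq_trans _ kM)// ltnS; apply: proper_card.
  apply/properP; split.
    apply/fintype.subsetP => j; rewrite !inE; apply: contra => /eqP Mj.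
    rewrite eq_le psd_mx_diag_ge0// andbT NE Mj sub0r oppr_le0.
    by rewrite mulr_ge0 ?sqr_ge0// invr_ge0 ltW.
  exists i; first by rewrite inE.
  by rewrite inE negbK NE expr2 mulrA mulVf// mul1r subrr.
exists ((Num.sqrt (M i i))^-1 *: col i M :: s); rewrite big_cons -Ns.
rewrite linearZ/= -scalemxAl -scalemxAr scalerA -invfM -expr2 sqr_sqrtr ?ltW//.
by rewrite /N addrC subrK.
Qed.

(** The product need not be symmetric, but each rank-one piece of [M] contributes
    [tr (w w^T N) = w^T N w]. *)
Lemma mxtrace_psd_mul_ge0 n (M N : 'M[K]_n) :
  psd_mx M -> psd_mx N -> 0 <= \tr (M *m N).
Proof.
move=> /psd_mx_sum_rank1[s ->] [_ Np].
rewrite mulmx_suml raddf_sum/= sumr_ge0// => w _.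
by rewrite -mulmxA mxtrace_mulC /mxtrace big_ord1.
Qed.

Lemma pd_mx_unit n (M : 'M[K]_n) : pd_mx M -> M \in unitmx.
Proof.
move=> [_ Mp]; rewrite unitmxE unitfE; apply/negP => /det0P[v v0 vM].
have := Mp v^T; rewrite trmxK vM mul0mx mxE ltxx => H.
by have /H : v^T != 0 by rewrite -(inj_eq trmx_inj) trmxK trmx0.
Qed.

Lemma psd_mx_inv n (M : 'M[K]_n) : pd_mx M -> psd_mx (invmx M).
Proof.
move=> Mpd; have Mu := pd_mx_unit Mpd.
have -> : invmx M = (invmx M)^T *m M *m invmx M.
  by case: Mpd => Ms _; rewrite trmx_inv Ms mulVmx// mul1mx.
exact/psd_mx_congr/pd_mx_psd.
Qed.

(** The trace is the sum of the squares of all entries. *)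
Lemma mxtrace_tr_mul_eq0 p q (M : 'M[K]_(p, q)) : \tr (M^T *m M) <= 0 -> M = 0.
Proof.
have -> : \tr (M^T *m M) = \sum_j \sum_i M i j ^+ 2.
  apply: eq_bigr => j _; rewrite mxE; apply: eq_bigr => i _.
  by rewrite mxE expr2.
move=> H; apply/matrixP => i j; rewrite mxE; apply/eqP.
have Mj k : 0 <= \sum_i M i k ^+ 2 by apply: sumr_ge0 => *; exact: sqr_ge0.
have /eqP : \sum_j \sum_i M i j ^+ 2 = 0 by apply/le_anti; rewrite H sumr_ge0.
rewrite psumr_eq0// => /allP/(_ j); rewrite mem_index_enum => /(_ isT)/=.
rewrite psumr_eq0 => [|*]; last exact: sqr_ge0.
by move=> /allP/(_ i); rewrite mem_index_enum sqrf_eq0 => /(_ isT).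
Qed.

End PsdMatrices.

(** * Riccati and Lyapunov vector fields and the Hamiltonian *)

Section RiccatiLyapunov.
Context {K : realType} {n : nat}.
Variables A D Q S : 'M[K]_n.

Definition riccati_field (P : 'M[K]_n) : 'M[K]_n :=
  - Q - A^T *m P - P *m A + P *m S *m P.

Definition lyapunov_field (P X : 'M[K]_n) : 'M[K]_n :=
  (A - S *m P) *m X + X *m (A - S *m P)^T + D.

(* Its trace is twice the Hamiltonian without the constant [varpi / 2]. *)
Definition hamiltonian_mx (X P : 'M[K]_n) : 'M[K]_n :=
  Q *m X + P *m (A *m X + X *m A^T + D) - P *m S *m P *m X.

Let mx_expand := (mulmxDl, mulmxDr, mulmxBl, mulmxBr, mulNmx, mulmxN, mulmxA).

(** One of the two canonical equations: the gradient in the covariance is minus the co-state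
    velocity. *)
Lemma hamiltonian_mx_linear X Y P :
  \tr (hamiltonian_mx X P) =
  \tr (hamiltonian_mx Y P) - \tr (riccati_field P *m (X - Y)).
Proof.
rewrite /hamiltonian_mx /riccati_field !mx_expand !(mxtraceD, mxtraceN).
have cyc Z : \tr (A^T *m P *m Z) = \tr (P *m Z *m A^T).
  by rewrite -mulmxA mxtrace_mulC.
by rewrite !cyc; ring.
Qed.

Lemma closed_loop_tr P : symmetric_mx S -> symmetric_mx P ->
  (A - S *m P)^T = A^T - P *m S.
Proof. by move=> Ss Ps; rewrite linearB/= trmx_mul Ss Ps. Qed.

(** The other canonical equation, as an exact second-order expansion at [P]: the linear coefficient
    is the covariance velocity, and the quadratic term has a sign when [S] and [X] are positive
    semidefinite. *)
Lemma hamiltonian_mx_concave X P Z :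
  symmetric_mx S -> symmetric_mx X -> symmetric_mx P -> symmetric_mx Z ->
  \tr (hamiltonian_mx X Z) =
  \tr (hamiltonian_mx X P) + \tr ((Z - P) *m lyapunov_field P X)
  - \tr ((Z - P) *m S *m (Z - P) *m X).
Proof.
move=> Ss Xs Ps Zs; rewrite /hamiltonian_mx /lyapunov_field closed_loop_tr//.
rewrite !mx_expand !(mxtraceD, mxtraceN).
have sym U V : symmetric_mx U -> symmetric_mx V ->
    \tr (U *m X *m V *m S) = \tr (U *m S *m V *m X).
  move=> Us Vs; rewrite -mxtrace_tr !trmx_mul Us Vs Ss Xs !mulmxA.
  by rewrite mxtrace_mulC !mulmxA.
have sym2 : \tr (P *m S *m Z *m X) = \tr (Z *m S *m P *m X).
  rewrite -mxtrace_tr !trmx_mul Zs Ps Ss Xs !mulmxA -!mulmxA mxtrace_mulC.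
  by rewrite !mulmxA.
by rewrite !sym// sym2; ring.
Qed.

(** By the canonical equations the derivative is [- tr (p' x') + tr (p' x') = 0]. *)
Lemma hamiltonian_mx_path (a b : K) (x p : K -> 'M[K]_n) :
  C1_path a b p (fun t => riccati_field (p t)) ->
  C1_path a b x (fun t => lyapunov_field (p t) (x t)) ->
  symmetric_mx S -> (forall t, a < t < b -> symmetric_mx (p t)) ->
  exists2 dh, C1_path a b (fun t => hamiltonian_mx (x t) (p t)) dh
    & forall t, a < t < b -> \tr (dh t) = 0.
Proof.
move=> pC xC Ss ps.
set dp := fun t => riccati_field _ in pC.
set dx := fun t => lyapunov_field _ _ in xC.
have cC (M : 'M[K]_n) := C1_path_cst a b M.
have hC := C1_pathB
  (C1_pathD (C1_pathM (cC Q) xC)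
    (C1_pathM pC (C1_pathD (C1_pathD (C1_pathM (cC A) xC)
                                     (C1_pathM xC (cC A^T))) (cC D))))
  (C1_pathM (C1_pathM (C1_pathM pC (cC S)) pC) xC).
eexists; first exact: hC.
move=> t tab /=; rewrite !(mul0mx, mulmx0, add0r, addr0).
have dpE : dp t = riccati_field (p t) by [].
have dxE : dx t = lyapunov_field (p t) (x t) by [].
move: (dp t) (dx t) dpE dxE => dpt dxt dpE dxE.
(* Expanding [tr (p' x')] once through the equation for [p] and once through that for [x] gives the
   cancellation. *)
have := erefl (\tr (dpt *m dxt)); rewrite {1}dpE [in RHS]dxE.
rewrite /riccati_field /lyapunov_field closed_loop_tr//; last exact: ps.
rewrite !mx_expand !(mxtraceD, mxtraceN).
have -> : \tr (A^T *m p t *m dxt) = \tr (p t *m dxt *m A^T).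
  by rewrite -mulmxA mxtrace_mulC.
have -> : \tr (dpt *m x t *m p t *m S) = \tr (p t *m S *m dpt *m x t).
  by rewrite -mulmxA mxtrace_mulC !mulmxA.
lra.
Qed.



Lemma riccati_field_bound (C : K) :
  exists2 c, 0 <= c & forall P, `|P| <= C -> `|riccati_field P| <= c.
Proof.
have [C0|C0] := leP 0 C; last first.
  by exists 0 => // P PC; have := normr_ge0 P; lra.
exists (`|Q| + n%:R * `|A| * C + n%:R * `|A| * C + n%:R * (n%:R * C * `|S|) * C).
  by rewrite !addr_ge0 ?mulr_ge0.
move=> P PC; rewrite /riccati_field.
apply: (le_trans (ler_normD _ _)); apply: lerD; first
  (apply: (le_trans (ler_normD _ _)); apply: lerD; first
    (apply: (le_trans (ler_normD _ _)); apply: lerD)); rewrite ?normrN//.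
- apply: (le_trans (mx_norm_mul _ _)); apply: ler_pM; rewrite ?mulr_ge0//.
  by rewrite ler_wpM2l// mx_norm_tr.
- apply: (le_trans (mx_norm_mul _ _)); rewrite mulrAC.
  by rewrite ler_pM ?mulr_ge0// ler_wpM2l.
- apply: (le_trans (mx_norm_mul _ _)); apply: ler_pM; rewrite ?mulr_ge0//.
  rewrite ler_wpM2l//; apply: (le_trans (mx_norm_mul _ _)).
  by rewrite ler_wpM2r// ler_wpM2l.
Qed.

(** Affine growth in [X] is the form of bound that [C1_path_increment] takes. *)
Lemma lyapunov_field_bound (C : K) :
  exists al de, [/\ 0 <= al, 0 <= de & forall P X, `|P| <= C ->
    `|lyapunov_field P X| <= al * `|X| + de].
Proof.
have [C0|C0] := leP 0 C; last first.
  by exists 0, 0; split => // P X PC; have := normr_ge0 P; lra.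
pose g := `|A| + n%:R * `|S| * C.
have g0 : 0 <= g by rewrite addr_ge0 ?mulr_ge0.
exists (n%:R * g + n%:R * g), `|D|; split => //.
  by rewrite addr_ge0 ?mulr_ge0.
move=> P X PC; have gP : `|A - S *m P| <= g.
  apply: (le_trans (ler_normB _ _)); rewrite lerD//.
  by apply: (le_trans (mx_norm_mul _ _)); rewrite ler_wpM2l// mulr_ge0.
apply: (le_trans (ler_normD _ _)); rewrite lerD//.
rewrite mulrDl; apply: (le_trans (ler_normD _ _)); apply: lerD.
  by apply: (le_trans (mx_norm_mul _ _)); rewrite ler_wpM2r// ler_wpM2l.
apply: (le_trans (mx_norm_mul _ _)); rewrite mulrAC ler_wpM2r// ler_wpM2l//.
exact: le_trans (mx_norm_tr _) gP.
Qed.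

End RiccatiLyapunov.

(** * Uniform bounds on Riccati solutions from controllability *)

Section RiccatiBounds.
Context {K : realType} {n m : nat}.
Variables (A : 'M[K]_n) (B : 'M[K]_(n, m)) (Q : 'M[K]_n) (R : 'M[K]_m).
Hypothesis Rpd : pd_mx R.
Let S : 'M[K]_n := B *m invmx R *m B^T.

(* Completing the square: the derivative of [x^T P x] along a controlled
   trajectory is the square minus the running cost [x^T Q x + u^T R u]. *)
Lemma riccati_square (P : 'M[K]_n) (x : 'cV[K]_n) (u : 'cV[K]_m) :
  symmetric_mx P ->
  \tr (((A *m x + B *m u)^T *m P + x^T *m riccati_field A Q S P) *m x
    + x^T *m P *m (A *m x + B *m u))
  = \tr ((R *m u + B^T *m P *m x)^T *m invmx R *m (R *m u + B^T *m P *m x))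
    - \tr (x^T *m Q *m x + u^T *m R *m u).
Proof.
move=> Ps; have Ru := pd_mx_unit Rpd; case: (Rpd) => Rs _.
have trD k l (M N : 'M[K]_(k, l)) : (M + N)^T = M^T + N^T by exact: linearD.
rewrite /riccati_field !trD !trmx_mul trmxK Ps Rs /S.
rewrite !(mulmxDl, mulmxDr, mulmxBl, mulmxBr, mulNmx, mulmxN, mulmxA).
rewrite !(mulmxKV Ru) !(mulmxK Ru).
by rewrite !(mxtraceD, mxtraceN); ring.
Qed.

(** After the mean value theorem the completed square is nonnegative, so only the running cost at
    the intermediate time remains. *)
Lemma riccati_lower_increment (T : K) (x : K -> 'cV[K]_n) (u : K -> 'cV[K]_m)
    (p : K -> 'M[K]_n) :
  0 < T -> is_solution T x (fun t => A *m x t + B *m u t) ->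
  C1_path 0 T p (fun t => riccati_field A Q S (p t)) ->
  (forall t, 0 < t < T -> symmetric_mx (p t)) ->
  exists2 c, 0 < c < T &
    - (\tr ((x c)^T *m Q *m x c + (u c)^T *m R *m u c) * T) <=
    \tr ((x T)^T *m p T *m x T) - \tr ((x 0)^T *m p 0 *m x 0).
Proof.
move=> T0 xC pC ps; have {}xC : C1_path 0 T x (fun t => A *m x t + B *m u t) := xC.
have [c cT ->] := C1_path_MVT T0 (C1_pathM (C1_pathM (C1_path_tr xC) pC) xC).
exists c => //; rewrite riccati_square ?subr0; last exact: ps.
rewrite mulrBl lerDr mulr_ge0 ?(ltW T0)//.
apply: mxtrace_psd; apply: psd_mx_congr; exact: psd_mx_inv.
Qed.

(** The equations are autonomous, so the steering trajectory may start at any time [t]; the maximum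
    of its running cost over [[0, T]] does not depend on [tf], [t] or [p]. *)
Lemma riccati_control_bound (T : K) (x : K -> 'cV[K]_n) (u : K -> 'cV[K]_m) :
  0 < T -> {within `[0, T], continuous u} ->
  is_solution T x (fun t => A *m x t + B *m u t) ->
  exists M : K, forall (tf t : K) (p : K -> 'M[K]_n),
    is_solution tf p (fun t => riccati_field A Q S (p t)) ->
    (forall t, 0 <= t <= tf -> symmetric_mx (p t)) ->
    0 < t -> t + T < tf ->
    - M <= \tr ((x T)^T *m p (t + T) *m x T) - \tr ((x 0)^T *m p t *m x 0).
Proof.
move=> T0 uc xC.
pose cost s := \tr ((x s)^T *m Q *m x s + (u s)^T *m R *m u s).
have [|c0] := @EVT_max K cost 0 T (ltW T0) _.
  move=> s; apply: cvg_mxtrace; have xs := xC.1 s; have us := uc s.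
  apply: cvgD; apply: cvg_mulmx => //; apply: cvg_mulmx; try exact: cvg_cst.
    exact: cvg_trmx xs.
  exact: cvg_trmx us.
move=> _ cmax; exists (cost c0 * T) => tf t p [_ pd] ps t0 tT.
have [|s sT|c /andP[c0' cT]] :=
    @riccati_lower_increment T x u (fun s => p (t + s)) T0 xC.
(* The strict inequalities put all of [[t, t + T]] inside the interval of differentiability of
   [p]. *)
- apply: C1_path_inside => s /andP[s0 sT]; apply: is_derive_shifted.
  by apply: pd; apply/andP; split; lra.
- by case/andP: sT => s0 sT; apply: ps; apply/andP; split; lra.
rewrite addr0; apply: le_trans; rewrite lerN2 ler_wpM2r ?(ltW T0)//.
by apply: cmax; rewrite in_itv/= !ltW.
Qed.

Hypothesis AB : controllable A B.

(** Steering [v] to 0 from time [t] bounds the form above; steering 0 to [v] so as to arrive at time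
    [t] bounds it below. [C] is both the bound and the margin that leaves room for these
    trajectories. Stating this for all large [C] allows finitely many vectors to be treated
    together. *)
Lemma riccati_quadratic_bound (v : 'cV[K]_n) :
  \forall C \near +oo, forall (tf t : K) (p : K -> 'M[K]_n),
    is_solution tf p (fun t => riccati_field A Q S (p t)) ->
    (forall t, 0 <= t <= tf -> symmetric_mx (p t)) ->
    C < t -> t + C < tf -> `|\tr (v^T *m p t *m v)| <= C.
Proof.
have [T1 [u1 [x1 [T10 u1c x1C x10 x1T]]]] := AB v 0.
have [T2 [u2 [x2 [T20 u2c x2C x20 x2T]]]] := AB 0 v.
have [M1 M1P] := riccati_control_bound T10 u1c x1C.
have [M2 M2P] := riccati_control_bound T20 u2c x2C.
near=> C => tf t p pC ps Ct tC.
have CT1 : T1 < C by near: C; apply: nbhs_pinfty_gt; exact: num_real.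
have CT2 : T2 < C by near: C; apply: nbhs_pinfty_gt; exact: num_real.
have CM1 : M1 < C by near: C; apply: nbhs_pinfty_gt; exact: num_real.
have CM2 : M2 < C by near: C; apply: nbhs_pinfty_gt; exact: num_real.
have := M1P tf t p pC ps; rewrite x10 x1T mulmx0 mxtrace0 sub0r lerN2 => H1.
have := M2P tf (t - T2) p pC ps; rewrite x20 x2T mulmx0 mxtrace0 subr0 subrK => H2.
rewrite ler_norml; apply/andP; split.
  have : - M2 <= \tr (v^T *m p t *m v) by apply: H2; lra.
  lra.
have : \tr (v^T *m p t *m v) <= M1 by apply: H1; lra.
lra.
Unshelve. all: by end_near. Qed.

(** Polarisation: an entry is half of the form at [e_i + e_j] minus the forms at [e_i] and [e_j],
    hence at most [3 C / 2]. *)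
Lemma riccati_bound :
  exists2 C : K, 0 < C & forall (tf t : K) (p : K -> 'M[K]_n),
    is_solution tf p (fun t => riccati_field A Q S (p t)) ->
    (forall t, 0 <= t <= tf -> symmetric_mx (p t)) ->
    C < t -> t + C < tf -> `|p t| <= C.
Proof.
pose bounded (v : 'cV[K]_n) (C : K) := forall (tf t : K) (p : K -> 'M[K]_n),
    is_solution tf p (fun t => riccati_field A Q S (p t)) ->
    (forall t, 0 <= t <= tf -> symmetric_mx (p t)) ->
    C < t -> t + C < tf -> `|\tr (v^T *m p t *m v)| <= C.
pose e i : 'cV[K]_n := delta_mx i 0.
suff : \forall C \near +oo, 0 < C /\
    forall ij : 'I_n * 'I_n, bounded (e ij.1) C /\ bounded (e ij.1 + 1 *: e ij.2) C.
  move=> /filter_ex[C [C0 Cb]]; exists (2 * C); first by rewrite mulr_gt0.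
  move=> tf t p pC ps Ct tC; apply: mx_norm_le => [|i j]; first by lra.
  have t0tf : 0 <= t <= tf by apply/andP; split; lra.
  have [bi bij] := Cb (i, j); have [bj _] := Cb (j, i).
  have tr11 (M : 'M[K]_1) : \tr M = M 0 0 by rewrite /mxtrace big_ord1.
  have := bi tf t p pC ps; have := bj tf t p pC ps; have := bij tf t p pC ps.
  rewrite !tr11/= quadratic_formD; last exact: ps.
  rewrite !delta_quadratic_form !ler_norml => Hij Hj Hi.
  have {Hij}/andP[? ?] := Hij ltac:(lra) ltac:(lra).
  have {Hj}/andP[? ?] := Hj ltac:(lra) ltac:(lra).
  have {Hi}/andP[? ?] := Hi ltac:(lra) ltac:(lra).
  by apply/andP; split; lra.
near=> C; split; first by near: C; apply: nbhs_pinfty_gt; exact: num_real.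
near: C; apply: filter_forall => ij.
near=> C; split; near: C; exact: riccati_quadratic_bound.
Unshelve. all: by end_near. Qed.

End RiccatiBounds.

(** * Turnpike windows and asymptotic bounds on the Hamiltonian *)

Section Turnpike.
Context {K : realType} {n : nat}.
Variables A D Q S : 'M[K]_n.

Variables X P : K -> K -> 'M[K]_n.
Hypothesis XP : forall tf : K, 0 < tf ->
  [/\ forall t, 0 <= t <= tf -> psd_mx (X tf t) /\ symmetric_mx (P tf t),
      is_solution tf (P tf) (fun t => riccati_field A Q S (P tf t))
    & is_solution tf (X tf) (fun t => lyapunov_field A D S (P tf t) (X tf t))].
Variable C : K.
Hypothesis C0 : 0 < C.
Hypothesis PC : forall tf t : K, 0 < tf -> C < t -> t + C < tf -> `|P tf t| <= C.
Variables (Xstar : K -> 'M[K]_n) (Xoo : 'M[K]_n).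
Hypothesis Xcvg : forall t : K, 0 <= t -> X tf t @[tf --> +oo] --> Xstar t.
Hypothesis Xstar_cvg : Xstar t @[t --> +oo] --> Xoo.

(** Pointwise convergence is used only at the finitely many points of a grid; between them the
    increment estimate takes over. The start [t1] is fixed before the length [L]. *)
Lemma turnpike_window (eps : K) : 0 < eps ->
  exists2 t1 : K, C < t1 & forall L : K, 0 < L -> \forall tf \near +oo,
    t1 + L + C < tf /\
    forall s, t1 <= s <= t1 + L -> `|P tf s| <= C /\ `|X tf s - Xoo| <= eps.
Proof.
move=> e0; have [al [de [al0 de0 lyap_le]]] := lyapunov_field_bound A D S C.
pose M := `|Xoo| + eps; pose B := al * M + de.
have M0 : 0 < M by rewrite ltr_wpDl.
have B0 : 0 <= B by rewrite addr_ge0 ?mulr_ge0// ltW.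
(* The first bound gives [h * al <= 1/2], as the increment estimate demands; the second keeps
   increments over one mesh below [eps / 2]. *)
pose h := Num.min (2 * al + 1)^-1 (eps / (4 * (B + 1))).
have h0 : 0 < h by rewrite lt_min invr_gt0 divr_gt0 ?mulr_gt0//; lra.
have hal : h * al <= 2^-1.
  have : h <= (2 * al + 1)^-1 by rewrite ge_min lexx.
  rewrite -[X in _ <= X]mul1r ler_pdivlMr; [nra|lra].
have hB : 2 * h * B <= eps / 2.
  have : h <= eps / (4 * (B + 1)) by rewrite ge_min lexx orbT.
  by rewrite ler_pdivlMr; [nra|lra].
move: h h0 hal hB => h h0 hal hB.
have [t1 Ct1 t1P] : exists2 t1, C < t1 &
    forall t, t1 <= t -> `|Xoo - Xstar t| <= eps / 4.
  have /cvgrPdist_le/(_ (eps / 4))[] := Xstar_cvg; first lra.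
  move=> t0 [_ t0P]; exists (Num.max C t0 + 1).
    by rewrite ltr_pwDr// le_max lexx.
  move=> t tt; apply: t0P; apply: lt_le_trans tt.
  by rewrite ltr_pwDr// le_max lexx orbT.
exists t1 => // L L0; pose N := (Num.truncn (L / h)).+1.
have t10 : 0 < t1 by exact: lt_trans Ct1.
near=> tf.
(* The extra [h] keeps the last mesh interval, which may pass [t1 + L], in the region where [P] is
   bounded. *)
have tfL : t1 + L + h + C < tf by near: tf; apply: nbhs_pinfty_gt; exact: num_real.
have tf0 : 0 < tf by have := C0; lra.
split; first lra.
have grid : forall k : 'I_N,
    `|Xstar (t1 + k%:R * h) - X tf (t1 + k%:R * h)| <= eps / 4.
  near: tf; apply: filter_forall => k.
  have kh : 0 <= t1 + k%:R * h by rewrite addr_ge0 ?mulr_ge0// ltW.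
  by have /cvgrPdist_le := Xcvg kh; apply; lra.
move=> s /andP[t1s sL]; split; first by apply: PC => //; lra.
have sh0 : 0 <= (s - t1) / h by rewrite divr_ge0 ?subr_ge0// ltW.
have /andP[ks sk] := truncn_itv sh0.
set k := Num.truncn _ in ks sk.
have kN : (k < N)%N.
  rewrite ltnS /k le_truncn// ler_pM2r ?invr_gt0//; lra.
rewrite ler_pdivlMr// in ks; rewrite ltr_pdivrMr// -natr1 mulrDl mul1r in sk.
(* [a] is the last grid point not after [s]; there [X tf] is within [eps / 4 + eps / 4] of [Xoo]. *)
set a := t1 + k%:R * h; have := grid (Ordinal kN); rewrite -/a /= => ga.
have kh0 : 0 <= k%:R * h by rewrite mulr_ge0// ltW.
have ga' := t1P a ltac:(rewrite /a; lra).
have aXoo : `|X tf a - Xoo| <= eps / 2.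
  rewrite distrC (le_trans (ler_distD (Xstar a) _ _))//; lra.
have aM : `|X tf a| <= M.
  rewrite -[X tf a](subrK Xoo) (le_trans (ler_normD _ _))// /M addrC lerD2l; lra.
have [XPpos Psol Xsol] := XP tf0.
have := @C1_path_increment K n n a (a + h) h M al de (X tf) _ al0 de0.
move=> /(_ (fun t => lyapunov_field A D S (P tf t) (X tf t))) incr.
have xC : C1_path a (a + h) (X tf)
    (fun t => lyapunov_field A D S (P tf t) (X tf t)).
  by apply: C1_path_sub Xsol; rewrite /a; have := C0; lra.
move: incr => /(_ ltac:(lra) ltac:(lra) hal xC aM) incr.
rewrite -(subrKA (X tf a)).
apply: (le_trans (ler_normD _ _)).
rewrite [leRHS](splitr eps) lerD//.
apply: (le_trans _ hB); apply: incr => [t /andP[at_ ta]|]; last by rewrite /a; lra.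
by apply: lyap_le; apply: PC => //; rewrite /a in at_ ta; lra.
Unshelve. all: by end_near. Qed.

Hypothesis Spsd : psd_mx S.

Let ham x p := \tr (hamiltonian_mx A D Q S x p).

Lemma hamiltonian_conserved (tf t : K) : 0 < t <= tf ->
  ham (X tf t) (P tf t) = ham (X tf 0) (P tf 0).
Proof.
move=> /andP[t0 ttf]; have tf0 : 0 < tf by lra.
have [XPpos Psol Xsol] := XP tf0.
have [t' /andP[t'0 t'tf]|dh hC dh0] :=
    hamiltonian_mx_path (C1_path_sub (lexx 0) ttf Psol)
                        (C1_path_sub (lexx 0) ttf Xsol) Spsd.1.
  by apply: (XPpos t' _).2; apply/andP; split; lra.
have [c ct] := C1_path_MVT t0 hC.
by rewrite dh0// mul0r => /eqP; rewrite subr_eq0 => /eqP.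
Qed.

Lemma hamiltonian_liminf (Z : 'M[K]_n) (eps : K) : symmetric_mx Z -> 0 < eps ->
  \forall tf \near +oo, ham Xoo Z <= ham (X tf 0) (P tf 0) + eps.
Proof.
move=> Zs eps0; have [c c0 cP] := riccati_field_bound A Q S C.
(* The summands account for replacing [X tf s] by [Xoo], for the term with [P'], and for the two
   endpoints of the window. *)
pose k := n%:R * n%:R * (`|riccati_field A Q S Z| + c + 2 * (`|Z| + C)).
have k0 : 0 <= k by rewrite mulr_ge0// !addr_ge0// mulr_ge0// addr_ge0// ltW.
pose d := eps / (k + 1).
have d0 : 0 < d by rewrite divr_gt0//; lra.
have kd : k * d <= eps by rewrite /d mulrA ler_pdivrMr; [nra|lra].
have [t1 Ct1 /(_ 1 ltr01)] := turnpike_window d0.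
apply: filterS => tf [tfL window].
have [t10 tf0] : 0 < t1 /\ 0 < tf by have := C0; lra.
have t1tf : t1 + 1 <= tf by have := C0; lra.
have [XPpos Psol Xsol] := XP tf0.
have sub p (x dx : K -> 'M[K]_(n, p)) (H : C1_path 0 tf x dx) :=
  C1_path_sub (ltW t10) t1tf H.
have pC := sub _ _ _ Psol; have xC := sub _ _ _ Xsol.
have cC (M : 'M[K]_n) := C1_path_cst t1 (t1 + 1) M.
(* This writes [tr ((Z - P) X')] at [s] as endpoint terms plus [tr (P' (X - Xoo))], each carrying
   the small factor [X - Xoo]. *)
have [|s /andP[t1s st1]] := C1_path_MVT _
  (C1_pathM (C1_pathB (cC Z) pC) (C1_pathB xC (cC Xoo))); first lra.
have [Ps Xs] := window s ltac:(lra).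
have [Pa Xa] := window t1 ltac:(lra).
have [Pb Xb] := window (t1 + 1) ltac:(lra).
rewrite sub0r subr0 mulNmx mxtraceD addrAC subrr add0r mulr1.
rewrite mxtraceN.
rewrite -(@hamiltonian_conserved tf s); last by apply/andP; split; lra.
have [Xpsd Psym] := XPpos s ltac:(lra).
have := hamiltonian_mx_linear A D Q S (X tf s) Xoo Z.
rewrite (hamiltonian_mx_concave A D Q Spsd.1 Xpsd.1 Psym Zs).
have : 0 <= \tr ((Z - P tf s) *m S *m (Z - P tf s) *m X tf s).
  apply: mxtrace_psd_mul_ge0 => //.
  have {1}-> : Z - P tf s = (Z - P tf s)^T.
    by rewrite /symmetric_mx in Zs Psym; rewrite linearB/= Zs Psym.
  exact: psd_mx_congr.
rewrite -/(ham _ _) -/(ham _ _).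
have bound (M N : 'M[K]_n) m : `|M| <= m -> `|N| <= d ->
    `|\tr (M *m N)| <= n%:R * n%:R * m * d.
  move=> Mm Nd; apply: (le_trans (mxtrace_mul_norm _ _)).
  by apply: ler_pM => //; rewrite ?mulr_ge0 ?ler_wpM2l ?mulr_ge0//.
have ZP p : `|p| <= C -> `|Z - p| <= `|Z| + C.
  by move=> pC'; rewrite (le_trans (ler_normB _ _))// lerD2l.
have := bound _ _ _ (lexx _) Xs => /(_ (riccati_field A Q S Z)).
have := bound _ _ _ (cP _ Ps) Xs.
have := bound _ _ _ (ZP _ Pa) Xa.
have := bound _ _ _ (ZP _ Pb) Xb.
rewrite !ler_norml => /andP[_ b1] /andP[b2 _] /andP[_ b3] /andP[_ b4] b5 b6 b7.
move: kd; rewrite /k; nra.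
Qed.

Lemma hamiltonian_limsup (Y : 'M[K]_n) (kappa eps : K) :
  (forall p, symmetric_mx p -> ham Y p <= kappa) -> 0 < eps ->
  \forall tf \near +oo, ham (X tf 0) (P tf 0) <= kappa + eps.
Proof.
move=> Yk eps0; have [c c0 cP] := riccati_field_bound A Q S C.
pose k := n%:R * n%:R * c; have k0 : 0 <= k by rewrite !mulr_ge0.
pose d := eps / (2 * (k + 1)).
have d0 : 0 < d by rewrite divr_gt0//; lra.
have kd : k * d <= eps / 2 by rewrite /d mulrA ler_pdivrMr; [nra|lra].
have [t1 Ct1] := turnpike_window d0.
pose l := n%:R * n%:R * C * `|Xoo - Y|.
have l0 : 0 <= l by rewrite !mulr_ge0// ltW.
(* The endpoint values of [tr (P (Xoo - Y))] differ by at most [2 * l]; averaged over length [L]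
   this is at most [eps / 2]. The added 1 keeps [L] positive when [l = 0]. *)
pose L := (4 * l + 1) / eps.
have L0 : 0 < L by rewrite divr_gt0//; lra.
have lL : 2 * l <= eps / 2 * L.
  have -> : eps / 2 * L = (4 * l + 1) / 2 by rewrite /L; field; rewrite gt_eqF.
  lra.
move=> /(_ L L0); apply: filterS => tf [tfL window].
have [t10 tf0] : 0 < t1 /\ 0 < tf by have := C0; lra.
have t1tf : t1 + L <= tf by have := C0; lra.
have [XPpos Psol Xsol] := XP tf0.
have pC := C1_path_sub (ltW t10) t1tf Psol.
have [|s /andP[t1s st1]] := C1_path_MVT _
  (C1_pathM pC (C1_path_cst t1 (t1 + L) (Xoo - Y))); first lra.
have [Ps Xs] := window s ltac:(lra).
have [Pa _] := window t1 ltac:(lra).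
have [Pb _] := window (t1 + L) ltac:(lra).
rewrite mulmx0 addr0 addrAC subrr add0r.
rewrite -(@hamiltonian_conserved tf s); last by apply/andP; split; lra.
have [Xpsd Psym] := XPpos s ltac:(lra).
have := Yk _ Psym; have := hamiltonian_mx_linear A D Q S (X tf s) Y (P tf s).
(* [X - Y] splits into [X - Xoo], small on the window, and the constant [Xoo - Y], handled by the
   mean value theorem. *)
rewrite -/(ham _ _) -/(ham _ _) -(subrKA Xoo) mulmxDr mxtraceD.
have bound (M N : 'M[K]_n) a b : `|M| <= a -> `|N| <= b ->
    `|\tr (M *m N)| <= n%:R * n%:R * a * b.
  move=> Mm Nd; apply: (le_trans (mxtrace_mul_norm _ _)).
  by apply: ler_pM => //; rewrite ?mulr_ge0 ?ler_wpM2l ?mulr_ge0//.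
have := bound _ _ _ _ (cP _ Ps) Xs.
have := bound _ _ _ _ Pa (lexx `|Xoo - Y|).
have := bound _ _ _ _ Pb (lexx `|Xoo - Y|).
rewrite -/l -/k !ler_norml => /andP[b1 _] /andP[_ b2] /andP[b3 _] b4 b5 b6.
have : - (eps / 2) <= \tr (riccati_field A Q S (P tf s) *m (Xoo - Y)).
  by rewrite -(ler_pM2r L0) -b6; lra.
lra.
Qed.

End Turnpike.

(** * Characterisation of asymptotic Hamiltonian-zeros *)

Lemma hamiltonianE (K : realType) (n m : nat) (A : 'M[K]_n) (B : 'M[K]_(n, m))
    (D Q : 'M[K]_n) (R : 'M[K]_m) (varpi : K) (X P : 'M[K]_n) :
  symmetric_mx X -> symmetric_mx P ->
  hamiltonian A B D Q R varpi X P =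
  2^-1 * (varpi + \tr (hamiltonian_mx A D Q (B *m invmx R *m B^T) X P)).
Proof.
move=> Xs Ps; rewrite /hamiltonian /hamiltonian_mx.
rewrite !mulmxDr !(mxtraceD, mxtraceN, mxtraceZ) !mulmxA.
(* Transposition identifies the two drift terms, by symmetry of [X] and [P]. *)
have -> : \tr (P *m X *m A^T) = \tr (P *m A *m X).
  by rewrite -mxtrace_tr !trmx_mul trmxK Xs Ps mxtrace_mulC -mulmxA mxtrace_mulC.
by field.
Qed.

Theorem theorem5p2 (K : realType) (n m r : nat)
  (A : 'M[K]_n) (B : 'M[K]_(n, m)) (Gamma : 'M[K]_(n, r)) (D Q : 'M[K]_n)
  (R : 'M[K]_m) (varpi : K) (Sigma0 Sigmaf : 'M[K]_n)
  (Sigma Pi : K -> K -> 'M[K]_n)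
  (HD : D = Gamma *m Gamma^T)
  (HQ : psd_mx Q)
  (HR : pd_mx R)
  (Hvarpi : 0 <= varpi)
  (HSigma0 : pd_mx Sigma0)
  (HSigmaf : pd_mx Sigmaf)
  (Hneq : Sigma0 <> Sigmaf)
  (HAB : controllable A B)
  (Hbvp : forall tf : K, 0 < tf ->
     bvp_solution A B D Q R Sigma0 Sigmaf tf (Sigma tf) (Pi tf))
  (Hapc : asymptotic_point_convergence Sigma) :
  asymptotic_hamiltonian_zero A B D Q R varpi Sigma Pi <->
  (varpi = 0 /\
   exists Sigmas : 'M[K]_n,
     [/\ pd_mx Sigmas,
         A *m Sigmas + Sigmas *m A^T + D = 0
       & \tr (Q *m Sigmas) = 0]).
Proof.
case: Hapc => Xstar [Xoo [Xcvg Xstar_cvg Xoo_pd]].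
pose S := B *m invmx R *m B^T.
have Spsd : psd_mx S.
  by have := psd_mx_congr B^T (psd_mx_inv HR); rewrite trmxK.
have sol (tf : K) : 0 < tf ->
    [/\ forall t, 0 <= t <= tf -> psd_mx (Sigma tf t) /\ symmetric_mx (Pi tf t),
      is_solution tf (Pi tf) (fun t => riccati_field A Q S (Pi tf t))
    & is_solution tf (Sigma tf)
        (fun t => lyapunov_field A D S (Pi tf t) (Sigma tf t))].
  move=> /Hbvp[pos [Pc Pd] Xsol _ _]; split=> //.
    by move=> t /pos[/pd_mx_psd].
  split=> // t /Pd; rewrite /riccati_field /S !mulmxA; exact.
have [C C0 Cb] := riccati_bound Q HR HAB.
have PC (tf t : K) : 0 < tf -> C < t -> t + C < tf -> `|Pi tf t| <= C.
  move=> /sol[pos Psol _]; apply: Cb Psol _ => s /pos[]//.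
have Hliminf := hamiltonian_liminf sol C0 PC Xcvg Xstar_cvg Spsd.
have Hlimsup := hamiltonian_limsup sol C0 PC Xcvg Xstar_cvg Spsd.
have trace_ge0 M : psd_mx M -> 0 <= \tr (Q *m M) by exact: mxtrace_psd_mul_ge0.
have quad_ge0 Z M : symmetric_mx Z -> psd_mx M -> 0 <= \tr (Z *m S *m Z *m M).
  move=> Zs Mp; apply: mxtrace_psd_mul_ge0 => //.
  by have := psd_mx_congr Z Spsd; rewrite Zs.
have HE (tf : K) : 0 < tf -> hamiltonian A B D Q R varpi (Sigma tf 0) (Pi tf 0) =
    2^-1 * (varpi + \tr (hamiltonian_mx A D Q S (Sigma tf 0) (Pi tf 0))).
  move=> tf0; have [pos _ _] := sol _ tf0.
  have [[Xs _] Ps] := pos 0 ltac:(lra).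
  exact: hamiltonianE.
have Xoo_psd := pd_mx_psd Xoo_pd.
split=> [H0|[varpi0 [Y [Ypd Ylyap YQ]]]].
  pose E := A *m Xoo + Xoo *m A^T + D.
  have Es : symmetric_mx E.
    rewrite /symmetric_mx /E HD.
    have trD (M N : 'M[K]_n) : (M + N)^T = M^T + N^T by exact: linearD.
    by rewrite !trD !trmx_mul !trmxK Xoo_psd.1 [X in X + _]addrC.
  (* [|H| <= e / 4] bounds the doubled Hamiltonian by [e / 2]; the liminf estimate costs another
     [e / 2]. *)
  have ham_le0 Z : symmetric_mx Z ->
      varpi + \tr (hamiltonian_mx A D Q S Xoo Z) <= 0.
    move=> Zs; apply/ler_addgt0Pr => e e0; rewrite add0r.
    have e4 : 0 < e / 4 by lra.
    have e2 : 0 < e / 2 by lra.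
    have /cvgrPdist_le/(_ _ e4) Hsmall := H0.
    have tf_pos : \forall tf \near (+oo : set_system K), 0 < tf.
      by apply: nbhs_pinfty_gt; exact: num_real.
    have [tf [[tf0 small] le]] := filter_ex
      (filterI (filterI tf_pos Hsmall) (Hliminf Z _ Zs e2)).
    move: small; rewrite /= sub0r normrN HE// ler_norml => /andP[_ ?]; lra.
  have hamZ d : \tr (hamiltonian_mx A D Q S Xoo (d *: E)) =
      \tr (Q *m Xoo) + d * \tr (E^T *m E) - d ^+ 2 * \tr (E *m S *m E *m Xoo).
    rewrite /hamiltonian_mx -/E Es -!scalemxAl -scalemxAr -scalemxAl.
    rewrite scalerA !(mxtraceD, mxtraceN) !mxtraceZ expr2.
    by [].
  have ineq d : 0 <= d -> varpi + \tr (Q *m Xoo) + d * \tr (E^T *m E) <=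
      d ^+ 2 * \tr (E *m S *m E *m Xoo).
    move=> d0; have : symmetric_mx (d *: E).
      by rewrite /symmetric_mx linearZ/= Es.
    by move=> /ham_le0; rewrite hamZ; lra.
  have Q0 := trace_ge0 _ Xoo_psd.
  have q0 := quad_ge0 E _ Es Xoo_psd.
  (* At [d = 0] the nonnegative numbers [varpi] and [tr (Q Xoo)] have sum at most 0. *)
  have := ineq 0 (lexx 0); rewrite expr0n !mul0r => H00.
  split; [lra|exists Xoo; split => //; last lra].
  rewrite -/E; apply: mxtrace_tr_mul_eq0; apply/ler_addgt0Pr => e e0; rewrite add0r.
  set q := \tr (E *m S *m E *m Xoo) in q0 ineq.
  (* Dividing [ineq] by [d > 0] leaves [tr (E^T E) <= d * q], and this [d] makes the right-hand side
     at most [e]. *)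
  pose d := e / (q + 1).
  have d0 : 0 < d by rewrite divr_gt0//; lra.
  have dq : d * q <= e by rewrite /d mulrAC ler_pdivrMr; [nra|lra].
  rewrite -(ler_pM2l d0); apply: le_trans (ler_wpM2l (ltW d0) dq).
  by have := ineq _ (ltW d0); rewrite mulrA -expr2; lra.
(* At [Y] the linear and constant terms in [p] vanish, leaving minus a nonnegative quadratic term;
   thus [kappa = 0] is admissible in the limsup bound. *)
have ham_le0 p : symmetric_mx p -> \tr (hamiltonian_mx A D Q S Y p) <= 0.
  move=> ps; rewrite /hamiltonian_mx Ylyap mulmx0 addr0 mxtraceD YQ add0r.
  rewrite mxtraceN oppr_le0.
  by apply: quad_ge0 => //; exact: pd_mx_psd.
apply/cvgrPdist_le => /= e e0; near=> tf.
have tf0 : 0 < tf by near: tf; apply: nbhs_pinfty_gt; exact: num_real.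
have up : \tr (hamiltonian_mx A D Q S (Sigma tf 0) (Pi tf 0)) <= 0 + e.
  by near: tf; exact: Hlimsup ham_le0 e0.
(* At [Z = 0] the Hamiltonian reduces to [tr (Q Xoo) >= 0]. *)
have lo : \tr (hamiltonian_mx A D Q S Xoo 0) <=
    \tr (hamiltonian_mx A D Q S (Sigma tf 0) (Pi tf 0)) + e.
  by near: tf; apply: Hliminf e0; exact: trmx0.
have {}lo : 0 <= \tr (hamiltonian_mx A D Q S (Sigma tf 0) (Pi tf 0)) + e.
  apply: le_trans lo; rewrite /hamiltonian_mx !mul0mx subr0 addr0.
  exact: trace_ge0.
rewrite sub0r normrN HE// varpi0 add0r ler_norml; apply/andP; split; lra.
Unshelve. all: by end_near. Qed.
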